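(* Let $K$ be a field, $S=K[x_0,\ldots,x_n]$ with $x_0<x_1<\cdots<x_n$, let $J\subseteq S$ be a strongly stable monomial ideal and let $I\subseteq S$ be a homogeneous ideal containing a $J$-marked set $G$. Then $\mathcal N(J)$ generates $S/I$ as a $K$-vector space. Thus $\dim_K I_m\ge \dim_K J_m$ for every $m\ge 0$.
   Context: A term is a monomial $x^\alpha=x_0^{\alpha_0}\cdots x_n^{\alpha_n}$. A monomial ideal $J$ is strongly stable if for every term $x^\alpha\in J$ and all $0\le i<j\le n$ with $\alpha_i>0$, the term $x_j x^\alpha/x_i$ belongs to $J$. $B_J$ is the minimal set of monomial generators of $J$ and $\mathcal N(J)$ is the set of terms not in $J$. A marked polynomial is a polynomial $f$ with a specified term $Ht(f)$ of its support, its head term. A $J$-marked set is a finite set $G$ of homogeneous marked polynomials $f_\alpha=x^\alpha-\sum c_{\alpha\gamma}x^\gamma$, with $c_{\alpha\gamma}\in K$ and $Ht(f_\alpha)=x^\alpha$, whose head terms are pairwise different and form exactly $B_J$, and such that every $x^\gamma$ appearing belongs to $\mathcal N(J)$. For a homogeneous ideal $I$, $I_m$ is the $K$-vector space of its homogeneous elements of degree $m$. *)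

(* Defs.v *)
From HB Require Import structures.
From Stdlib Require Import ClassicalEpsilon.
From mathcomp Require Import all_boot all_order all_algebra.
From mathcomp.multinomials Require Import mpoly.
Set Implicit Arguments.
Unset Strict Implicit.
Unset Printing Implicit Defensive.
Import GRing.Theory.
Local Open Scope ring_scope.

(* Ideals are Prop-valued predicates: membership need not be decidable, and
   the unit ideal is allowed (unlike with GRing's proper ideals). *)
Definition is_ideal (R : comNzRingType) (I : R -> Prop) : Prop :=
  [/\ I 0, forall f g, I f -> I g -> I (f + g) & forall h f, I f -> I (h * f)].

Definition ideal_gen (R : comNzRingType) (A : R -> Prop) (f : R) : Prop :=
  forall I : R -> Prop, is_ideal I -> (forall a, A a -> I a) -> I f.

(* The polynomial ring K[x_0, ..., x_n] is {mpoly K[n.+1]}; a term is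
   identified with its exponent m : 'X_{1..n.+1}, and 'X_[m] is the term seen as
   a polynomial. *)
Section Terms.
Variables (K : fieldType) (n : nat).
Implicit Types (I J : {mpoly K[n]} -> Prop) (B : 'X_{1..n} -> Prop).

Definition generated_by_terms J B : Prop :=
  forall f, J f <-> ideal_gen (fun g => exists2 m, B m & g = 'X_[m]) f.

Definition monomial_ideal J : Prop := exists B, generated_by_terms J B.

(* Truncated subtraction is harmless here, as x_i divides x^m. *)
Definition strongly_stable J : Prop :=
  forall m : 'X_{1..n}, J 'X_[m] ->
  forall i j : 'I_n, (i < j)%N -> (0 < m i)%N -> J 'X_[m + U_(j) - U_(i)].

(* B is minimal, with respect to inclusion, among the sets of terms generating
   J; a monomial ideal has exactly one such set. *)
Definition minimal_term_generators J B : Prop :=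
  generated_by_terms J B /\
  forall A : 'X_{1..n} -> Prop, generated_by_terms J A ->
    (forall m, A m -> B m) -> forall m, B m -> A m.

Definition terms_outside J : 'X_{1..n} -> Prop := fun m => ~ J 'X_[m].

Definition homogeneous_ideal I : Prop :=
  is_ideal I /\ forall d f, I f -> I (pihomog mdeg d f).

(* The classes of the terms in B span the quotient by I: two polynomials have
   the same class exactly when their difference is in I. *)
Definition terms_span_quotient I B : Prop :=
  forall f : {mpoly K[n]},
  exists (s : seq 'X_{1..n}) (c : 'X_{1..n} -> K),
    (forall m, m \in s -> B m) /\ I (f - \sum_(m <- s) c m *: 'X_[m]).

Record marked_poly := MarkedPoly {
  marked_val : {mpoly K[n]} * 'X_{1..n};
  _ : marked_val.2 \in msupp marked_val.1 }.

HB.instance Definition _ := [isSub for marked_val].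
HB.instance Definition _ := [Choice of marked_poly by <:].

Definition mpoly_of (f : marked_poly) : {mpoly K[n]} := (marked_val f).1.
Definition Ht (f : marked_poly) : 'X_{1..n} := (marked_val f).2.

(* In the last clause, 'X_[Ht f] - mpoly_of f is the sum of the c_{alpha gamma}
   x^gamma; since x^(Ht f) is in J, the clause forces the head coefficient to
   be 1. *)
Definition marked_set J (G : seq marked_poly) : Prop :=
  [/\ uniq (map Ht G),
      minimal_term_generators J (fun m => m \in map Ht G),
      forall f, f \in G -> mpoly_of f \is homog mdeg
    & forall f, f \in G ->
      forall m, m \in msupp ('X_[Ht f] - mpoly_of f) -> terms_outside J m].

End Terms.

(* The subspace with carrier W, when W is closed under linear combinations
   (see vspace_ofP); unspecified otherwise. *)
Definition vspace_of (K : fieldType) (V : vectType K) (W : V -> Prop) :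
    {vspace V} :=
  epsilon (inhabits 0%VS) (fun U : {vspace V} => forall v, v \in U <-> W v).

Lemma vspace_ofP (K : fieldType) (V : vectType K) (W : V -> Prop) :
  W 0 -> (forall c u v, W u -> W v -> W (c *: u + v)) ->
  forall v, v \in vspace_of W <-> W v.
Proof.
move=> W0 WL.
suff exU : exists U : {vspace V}, forall v, v \in U <-> W v.
  exact: (epsilon_spec (inhabits 0%VS)
           (fun U : {vspace V} => forall v, v \in U <-> W v) exU).
have grow k (U : {vspace V}) : (\dim {:V} - \dim U <= k)%N ->
    (forall v, v \in U -> W v) ->
    exists U : {vspace V}, forall v, v \in U <-> W v.
  elim: k U => [|k IHk] U dimU UW.
    have /eqP Ufull : U == fullv.
      by rewrite eqEdim subvf -subn_eq0 -leqn0.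
    by exists U => v; split=> [/UW //|_]; rewrite Ufull memvf.
  have [|noW] := excluded_middle_informative (exists2 v, W v & v \notin U).
    case=> v Wv vU; apply: (IHk (U + <[v]>)%VS).
      have ltU : (\dim U < \dim (U + <[v]>))%N.
        rewrite ltn_neqAle dimvS ?addvSl // andbT.
        apply: contra vU => /eqP dimE.
        have /eqP-> : U == (U + <[v]>)%VS by rewrite eqEdim addvSl dimE leqnn.
        by apply: (subvP (addvSr U _)); apply: memv_line.
      rewrite leq_subLR; rewrite leq_subLR in dimU.
      by apply: (leq_trans dimU); rewrite addnS -addSn leq_add2r.
    move=> w /memv_addP[u /UW Wu [x /vlineP[c ->] ->]].
    by rewrite addrC; apply: WL.
  exists U => v; split=> [/UW //|Wv]; apply: contraT => vU.
  by case: noW; exists v.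
apply: (grow _ 0%VS (leqnn _)) => v; rewrite memv0 => /eqP->; exact: W0.
Qed.

(* dhomog n.+1 K d is the K-vector space of homogeneous polynomials of degree d
   (0 included). *)
Definition homog_part (K : fieldType) (n : nat) (I : {mpoly K[n.+1]} -> Prop)
    (d : nat) : {vspace dhomog n.+1 K d} :=
  vspace_of (fun f : dhomog n.+1 K d => I (mpoly_of_dhomog f)).

Lemma homog_partP (K : fieldType) (n : nat) (I : {mpoly K[n.+1]} -> Prop)
    (d : nat) : is_ideal I ->
  forall f : dhomog n.+1 K d, f \in homog_part I d <-> I (mpoly_of_dhomog f).
Proof.
case=> I0 ID IM; apply: vspace_ofP => [|c u v Iu Iv]; first by rewrite linear0.
by rewrite linearP /=; apply: ID => //; rewrite -mul_mpolyC; apply: IM.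
Qed.

(* Main.v *)
(* By strong stability every term of J is x^b x^d with b in B_J and
   max(x^d) <= min(x^b).  Replacing the head term of x^d f_b by its tail yields
   terms x^(c + d) with x^c outside J; those still in J decompose as x^b' x^d'
   with d' lexicographically smaller than d, so the rewriting terminates (within
   a fixed degree, compare the d's as integers written in a large base).
   Hence I_m + N(J)_m is everything, while J_m meets N(J)_m trivially. *)
Require Import Defs.
From mathcomp Require Import all_boot all_order all_algebra.
From mathcomp.multinomials Require Import mpoly.
Set Implicit Arguments.
Unset Strict Implicit.
Unset Printing Implicit Defensive.

(** * Lexicographic comparison of base-[D] expansions *)

(** Induction on the number of digits: the lowest digit is split off, and the remaining digits,
    which form the quotient by [D], decide first. *)
Lemma leq_digit_sum (D n : nat) (f g : 'I_n -> nat) :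
  (forall i, f i < D) -> (forall i, g i < D) ->
  \sum_i f i * D ^ i <= \sum_i g i * D ^ i ->
  f =1 g \/ exists2 j : 'I_n, f j < g j & forall k : 'I_n, j < k -> f k = g k.
Proof.
elim: n f g => [|n IHn] f g fD gD; first by left; case.
have split_low (h : 'I_n.+1 -> nat) : \sum_i h i * D ^ i
    = h ord0 + (\sum_(i < n) h (lift ord0 i) * D ^ i) * D.
  rewrite big_ord_recl muln1 big_distrl /=; congr (_ + _).
  by apply: eq_bigr => i _; rewrite /bump /= add1n expnSr mulnA.
rewrite !split_low => le_fg.
have le_high : \sum_(i < n) f (lift ord0 i) * D ^ i
    <= \sum_(i < n) g (lift ord0 i) * D ^ i.
  (* A deficit in the quotients costs at least [D], which the single digit [g ord0 < D] cannot make
     up. *)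
  rewrite leqNgt; apply/negP => lt_gf; move: le_fg; apply/negP.
  rewrite -ltnNge; have := gD ord0; move: lt_gf; rewrite -(leq_pmul2r (m := D)).
    rewrite mulSn => lt_gf g0; apply: leq_trans (leq_addl _ _).
    by apply: leq_trans lt_gf; rewrite ltn_add2r.
  by apply: leq_ltn_trans (gD ord0).
have [eq_high|[j ltj eqj]] := IHn _ _ (fun i => fD _) (fun i => gD _) le_high.
  move: le_fg; under eq_bigr do rewrite eq_high.
  rewrite leq_add2r leq_eqVlt => /predU1P[eq0|lt0]; [left|right].
    by move=> i; case: (unliftP ord0 i) => [i'|] ->.
  by exists ord0 => // k; case: (unliftP ord0 k) => [k'|] -> // _.
right; exists (lift ord0 j) => // k.
by case: (unliftP ord0 k) => [k'|] -> //; apply: eqj.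
Qed.

Section Span.

Import GRing.Theory.
Local Open Scope ring_scope.

(** * Polynomials supported on a set of terms, and monomial ideals *)

Definition supported (K : fieldType) (n : nat) (P : 'X_{1..n} -> Prop)
    (f : {mpoly K[n]}) : Prop :=
  forall m, m \in msupp f -> P m.

Lemma supported0 (K : fieldType) (n : nat) (P : 'X_{1..n} -> Prop) :
  supported P (0 : {mpoly K[n]}).
Proof. by move=> m; rewrite msupp0. Qed.

Lemma supportedD (K : fieldType) (n : nat) (P : 'X_{1..n} -> Prop)
    (f g : {mpoly K[n]}) :
  supported P f -> supported P g -> supported P (f + g).
Proof.
by move=> Pf Pg m /msuppD_le; rewrite mem_cat => /orP[/Pf|/Pg].
Qed.

Lemma supportedZ (K : fieldType) (n : nat) (P : 'X_{1..n} -> Prop)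
    (c : K) (f : {mpoly K[n]}) : supported P f -> supported P (c *: f).
Proof. by move=> Pf m /msuppZ_le /Pf. Qed.

Lemma supportedX (K : fieldType) (n : nat) (P : 'X_{1..n} -> Prop) m :
  supported P ('X_[m] : {mpoly K[n]}) <-> P m.
Proof.
by split=> [|Pm m' /mem_msuppXP <- //]; apply; apply/mem_msuppXP.
Qed.

Lemma supported_pihomog (K : fieldType) (n : nat) (P : 'X_{1..n} -> Prop) d
    (f : {mpoly K[n]}) : supported P f -> supported P (pihomog mdeg d f).
Proof.
move=> Pf; rewrite pihomogE big_seq_cond.
apply: (big_ind (supported P)) => [|g h|m /andP[/Pf Pm _]].
- exact: supported0.
- exact: supportedD.
- by apply: supportedZ; apply/supportedX.
Qed.

Lemma ideal_sum (R : comNzRingType) (I : R -> Prop) (A : eqType) (s : seq A)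
    (F : A -> R) :
  is_ideal I -> (forall a, a \in s -> I (F a)) -> I (\sum_(a <- s) F a).
Proof.
by case=> I0 ID _ IF; rewrite big_seq; apply: (big_ind I) => // a /IF.
Qed.

Lemma idealZ (K : fieldType) (n : nat) (I : {mpoly K[n]} -> Prop) c f :
  is_ideal I -> I f -> I (c *: f).
Proof. by case=> _ _ IM If; rewrite -mul_mpolyC; apply: IM. Qed.

(** Polynomials supported on multiples of terms of [B] form an ideal containing those terms;
    conversely, any ideal containing them absorbs such a polynomial monomial by monomial. *)
Lemma generated_by_terms_supported (K : fieldType) (n : nat)
    (J : {mpoly K[n]} -> Prop) (B : 'X_{1..n} -> Prop) :
  generated_by_terms J B ->
  forall f, J f <-> supported (fun m => exists2 b, B b & (b <= m)%MM) f.
Proof.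
move=> JB f; rewrite JB; split=> [JBf|Bf I I_ideal BI].
  apply: JBf => [|_ [b Bb ->]]; last first.
    by apply/supportedX; exists b => //; apply: lepm_refl.
  split=> [|g h|h g Pg m].
  - exact: supported0.
  - exact: supportedD.
  - case/msuppM_le/allpairsP=> -[u v] /= [_ /Pg[b Bb bv] ->].
    by exists b => //; apply: lepm_trans bv (lem_addl _ _).
rewrite [f]mpolyE; apply: ideal_sum => // m /Bf[b Bb bm].
apply: idealZ => //; rewrite -(submK bm) mpolyXD.
by case: I_ideal => _ _; apply; apply: BI; exists b.
Qed.

Lemma generated_by_terms_monomial (K : fieldType) (n : nat)
    (J : {mpoly K[n]} -> Prop) (B : 'X_{1..n} -> Prop) :
  generated_by_terms J B ->
  forall m, J 'X_[m] <-> exists2 b, B b & (b <= m)%MM.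
Proof.
by move=> JB m; rewrite (generated_by_terms_supported JB) supportedX.
Qed.

Lemma monomial_ideal_supported (K : fieldType) (n : nat)
    (J : {mpoly K[n]} -> Prop) :
  monomial_ideal J -> forall f, J f <-> supported (fun m => J 'X_[m]) f.
Proof.
case=> B JB f; rewrite (generated_by_terms_supported JB).
by split=> Pf m /Pf /(generated_by_terms_monomial JB).
Qed.

(** * Star decompositions and the weight that decreases *)

(* max(x^d) <= min(x^b), the largest and smallest variables occurring. *)
Definition star (n : nat) (b d : 'X_{1..n}) : Prop :=
  forall i j : 'I_n, (0 < b i)%N -> (0 < d j)%N -> (j <= i)%N.

(** Induction on the degree. Unless x^m is itself a generator, dividing it by its smallest variable
    x_i stays in [J]; multiplying the second factor by x_i afterwards preserves [star], because no
    variable of x^m is smaller than x_i. *)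
Lemma star_decomposition (K : fieldType) (n : nat) (J : {mpoly K[n]} -> Prop)
    (B : 'X_{1..n} -> Prop) :
  generated_by_terms J B -> strongly_stable J ->
  forall m, J 'X_[m] -> exists b d, [/\ B b, star b d & m = (b + d)%MM].
Proof.
move=> JB J_stable m; have [k] := ubnP (mdeg m).
elim: k m => // k IHk m lt_mk Jm.
have JE := generated_by_terms_monomial JB.
have [b Bb bm] : exists2 b, B b & (b <= m)%MM by apply/JE.
have [eq_bm|ne_bm] := eqVneq b m.
  exists b, 0%MM; rewrite addm0 eq_bm; split=> //; first by rewrite -eq_bm.
  by move=> i j _; rewrite mnm0E.
have [j lt_bj] : exists j, (b j < m j)%N.
  apply/existsP; apply: contraNT ne_bm => /existsPn le_mb.
  apply/eqP/mnmP => i; apply/eqP; rewrite eqn_leq (mnm_lepP bm) /=.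
  by rewrite leqNgt.
have mj_gt0 : (0 < m j)%N by apply: leq_ltn_trans lt_bj.
have Jmj : J 'X_[m - U_(j)].
  apply/JE; exists b => //; apply/mnm_lepP => i; rewrite mnmBE mnm1E.
  by case: eqVneq => [<-|_];
    rewrite ?subn0 ?(mnm_lepP bm) // subn1 -ltnS prednK.
case: (arg_minnP (P := [pred i | (0 < m i)%N]) (@nat_of_ord n) mj_gt0).
move=> i /= mi_gt0 min_i.
have Ui_le : (U_(i) <= m)%MM by rewrite lep1mP -lt0n.
(* Strong stability, applied to x^m / x_j, trades x_i for the larger x_j and yields x^m / x_i. *)
have Jmi : J 'X_[m - U_(i)].
  have [<- //|ne_ij] := eqVneq j i.
  have lt_ij : (i < j)%N.
    by rewrite ltn_neqAle min_i // andbT eq_sym.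
  have := J_stable _ Jmj i j lt_ij; rewrite mnmBE mnm1E (negPf ne_ij) subn0.
  by rewrite submK ?lep1mP -?lt0n //; apply.
have [||b' [d [Bb' star_bd def_m]]] := IHk (m - U_(i))%MM.
- move: lt_mk; rewrite -{1}(submK Ui_le) mdegD mdeg1 addn1 ltnS.
  exact.
- exact: Jmi.
exists b', (d + U_(i))%MM; split=> //; last by rewrite addmA -def_m submK.
move=> k1 k2 bk1; rewrite mnmDE mnm1E; case: (eqVneq i k2) => [<- _|_].
  apply: min_i; apply: leq_trans (bk1 : (0 < b' k1)%N) _.
  have := mnm_lepP (lem_subr m U_(i)) k1; rewrite def_m mnmDE.
  by apply: leq_trans; apply: leq_addr.
by rewrite addn0; apply: star_bd.
Qed.

(** Exponents serve as digits, the largest variable being the most significant, so that termination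
    becomes induction on a natural number. *)
Definition lex_weight (D n : nat) (d : 'X_{1..n}) : nat :=
  (\sum_i d i * D ^ i)%N.

(* If d' were not lexicographically smaller than d, then b' would vanish below
   the top index where d' exceeds d, and b' would divide c. *)
Lemma star_reduction_decreases (D n : nat) (b' d' c d : 'X_{1..n}) :
  (forall i, d i < D)%N -> (forall i, d' i < D)%N ->
  star b' d' -> (c + d = b' + d')%MM -> ~ (b' <= c)%MM ->
  (lex_weight D d' < lex_weight D d)%N.
Proof.
move=> dD d'D star_bd /mnmP cd nbc; rewrite ltnNge; apply/negP => le_w.
apply: nbc; apply/mnm_lepP => i; move: (cd i); rewrite !mnmDE.
have [eq_d|[j ltj eqj]] := leq_digit_sum dD d'D le_w.
  by rewrite eq_d => /addIn ->.
case: (ltngtP i j) => [lt_ij|lt_ji|/val_inj ->].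
- case: (posnP (b' i)) => [-> //|b'i].
  have := star_bd i j b'i (leq_ltn_trans (leq0n _) ltj).
  by rewrite leqNgt lt_ij.
- by rewrite eqj // => /addIn ->.
(* At [j] itself, [c j + d j = b' j + d' j] together with [d j < d' j] bounds [b' j] by [c j]. *)
- by move=> eq_j; rewrite -(leq_add2r (d j)) eq_j leq_add2l ltnW.
Qed.

(** * Reduction modulo an ideal *)

Definition reducible_modulo (K : fieldType) (n : nat)
    (I : {mpoly K[n]} -> Prop) (P : 'X_{1..n} -> Prop) (f : {mpoly K[n]}) :=
  exists2 g, supported P g & I (f - g).

Lemma reducible_supported (K : fieldType) (n : nat)
    (I : {mpoly K[n]} -> Prop) (P : 'X_{1..n} -> Prop) f :
  is_ideal I -> supported P f -> reducible_modulo I P f.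
Proof. by case=> I0 _ _ Pf; exists f => //; rewrite subrr. Qed.

Lemma reducibleD (K : fieldType) (n : nat)
    (I : {mpoly K[n]} -> Prop) (P : 'X_{1..n} -> Prop) f1 f2 :
  is_ideal I -> reducible_modulo I P f1 -> reducible_modulo I P f2 ->
  reducible_modulo I P (f1 + f2).
Proof.
case=> _ ID _ [g1 Pg1 Ig1] [g2 Pg2 Ig2].
exists (g1 + g2); first exact: supportedD.
by rewrite opprD addrACA; apply: ID.
Qed.

Lemma reducible_sum (K : fieldType) (n : nat)
    (I : {mpoly K[n]} -> Prop) (P : 'X_{1..n} -> Prop) (s : seq 'X_{1..n})
    (c : 'X_{1..n} -> K) (F : 'X_{1..n} -> {mpoly K[n]}) :
  is_ideal I -> (forall m, m \in s -> reducible_modulo I P (F m)) ->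
  reducible_modulo I P (\sum_(m <- s) c m *: F m).
Proof.
move=> I_ideal red_F; rewrite big_seq.
apply: big_ind => [|f g|m /red_F[g Pg Ig]].
- by apply: reducible_supported => //; apply: supported0.
- exact: reducibleD.
- exists (c m *: g); first exact: supportedZ.
  by rewrite -scalerBr; apply: idealZ.
Qed.

(** Keeps rewriting within one degree, so that a single base [D] serves for all weights. *)
Lemma marked_set_tail_mdeg (K : fieldType) (n : nat)
    (J : {mpoly K[n]} -> Prop) (G : seq (marked_poly K n)) :
  marked_set J G -> forall f, f \in G ->
  forall m, m \in msupp ('X_[Ht f] - mpoly_of f) -> mdeg m = mdeg (Ht f).
Proof.
case=> _ _ G_homog _ f /G_homog /homogP[d /dhomogP f_homog] m.
have Ht_f : mdeg (Ht f) = d by apply: f_homog; case: (f).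
move/msuppB_le; rewrite mem_cat => /orP[/mem_msuppXP <- //|/f_homog].
by rewrite Ht_f.
Qed.

Lemma reducible_term (K : fieldType) (n : nat) (J I : {mpoly K[n]} -> Prop)
    (G : seq (marked_poly K n)) :
  strongly_stable J -> is_ideal I -> marked_set J G ->
  (forall f, f \in G -> I (mpoly_of f)) ->
  forall m, reducible_modulo I (terms_outside J) 'X_[m].
Proof.
move=> J_stable I_ideal G_marked G_in_I m.
have [_ [JB _] _ tail_out] := G_marked.
have split_term m1 : terms_outside J m1 \/ exists b d,
    [/\ b \in map (@Ht K n) G, star b d & m1 = (b + d)%MM].
  have [Jm1|nJm1] := Classical_Prop.classic (J 'X_[m1]); last by left.
  by right; apply: star_decomposition Jm1.
(* No exponent in a term of degree [mdeg m] reaches this base. *)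
set D := (mdeg m).+1.
have bounded (b d : 'X_{1..n}) : mdeg (b + d) = mdeg m ->
    forall i, (d i < D)%N.
  move=> deg_bd i; rewrite ltnS -deg_bd mdegD [mdeg d]mdegE.
  by rewrite (bigD1 i) //= addnCA leq_addr.
have reduce k b d : b \in map (@Ht K n) G -> star b d ->
    mdeg (b + d) = mdeg m -> (lex_weight D d < k)%N ->
    reducible_modulo I (terms_outside J) 'X_[b + d].
  elim: k b d => // k IHk _ d /mapP[f Gf ->] star_bd deg_bd lt_dk.
  (* The second summand is a multiple of [f], hence in [I]; only the tail times x^d remains to be
     reduced. *)
  have -> : 'X_[Ht f + d] =
      ('X_[Ht f] - mpoly_of f) * 'X_[d] + 'X_[d] * mpoly_of f.
    by rewrite mulrBl -mpolyXD [_ * 'X_[d]]mulrC subrK.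
  apply: reducibleD => //; last first.
    exists 0; first exact: supported0.
    by rewrite subr0; case: I_ideal => _ _; apply; apply: G_in_I.
  rewrite ['X_[Ht f] - _]mpolyE mulr_suml.
  under eq_bigr do rewrite -scalerAl -mpolyXD.
  apply: reducible_sum => // c tail_c.
  have [out_cd|[b' [d' [Gb' star_bd' def_cd]]]] := split_term (c + d)%MM.
    by apply: reducible_supported => //; apply/supportedX.
  have deg_cd : mdeg (b' + d') = mdeg m.
    by rewrite -def_cd mdegD (marked_set_tail_mdeg G_marked Gf) // -mdegD.
  rewrite def_cd; apply: IHk => //; apply: leq_trans _ (lt_dk : _ <= k)%N.
  apply: star_reduction_decreases star_bd' def_cd _.
  - exact: bounded deg_bd.
  - exact: bounded deg_cd.
  (* A generator dividing the tail term x^c would put x^c in [J]. *)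
  - move=> le_bc; apply: (tail_out f Gf c tail_c).
    by apply/(generated_by_terms_monomial JB); exists b'.
have [out_m|[b [d [Gb star_bd def_m]]]] := split_term m.
  by apply: reducible_supported => //; apply/supportedX.
by rewrite def_m; apply: reduce (ltnSn _); rewrite // -def_m.
Qed.

Lemma reducible_marked (K : fieldType) (n : nat) (J I : {mpoly K[n]} -> Prop)
    (G : seq (marked_poly K n)) :
  strongly_stable J -> is_ideal I -> marked_set J G ->
  (forall f, f \in G -> I (mpoly_of f)) ->
  forall f, reducible_modulo I (terms_outside J) f.
Proof.
move=> J_stable I_ideal G_marked G_in_I f; rewrite [f]mpolyE.
by apply: reducible_sum => // m _; apply: reducible_term G_in_I m.
Qed.

(** * Comparison of dimensions in a fixed degree *)

Lemma is_ideal_monomial (K : fieldType) (n : nat)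
    (J : {mpoly K[n]} -> Prop) : monomial_ideal J -> is_ideal J.
Proof.
case=> B JB; split=> [|f g /JB Jf /JB Jg|h f /JB Jf]; apply/JB => I I_ideal BI.
- by case: I_ideal.
- by have [_ ID _] := I_ideal; apply: ID; [apply: Jf | apply: Jg].
- by have [_ _ IM] := I_ideal; apply: IM; apply: Jf.
Qed.

(* The span N_d of the terms outside J meets J_d trivially, whereas N_d + I_d is
   the whole space S_d. *)
Lemma dim_homog_part_le (K : fieldType) (n : nat)
    (J I : {mpoly K[n.+1]} -> Prop) :
  monomial_ideal J -> homogeneous_ideal I ->
  (forall f, reducible_modulo I (terms_outside J) f) ->
  forall d, (\dim (homog_part J d) <= \dim (homog_part I d))%N.
Proof.
move=> J_monomial [I_ideal I_homog] red_I d.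
have J_ideal := is_ideal_monomial J_monomial.
set out := fun f : dhomog n.+1 K d => supported (terms_outside J) (val f).
have N_P f : f \in vspace_of out <-> out f.
  apply: vspace_ofP => [|c u v]; rewrite /out.
    by rewrite [val _]linear0; apply: supported0.
  rewrite [val (_ + _)]linearP => out_u out_v.
  by apply: supportedD => //; apply: supportedZ.
have cap0 : (homog_part J d :&: vspace_of out = 0)%VS.
  apply/eqP; rewrite -subv0; apply/subvP => f; rewrite memv_cap memv0.
  case/andP => /(homog_partP J_ideal)/(monomial_ideal_supported J_monomial) Jf.
  move/N_P => out_f; apply/eqP/val_inj; rewrite [RHS]linear0 /=.
  apply: msuppnil0; case def_s: (msupp _) => [//|m s].
  have m_f : m \in msupp (val f) by rewrite def_s mem_head.
  by case: (out_f m m_f); apply: Jf.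
have sum_full : (homog_part I d + vspace_of out = fullv)%VS.
  apply/eqP; rewrite eqEsubv subvf; apply/subvP => f _.
  have [g out_g Ig] := red_I (val f).
  (* Since [f] is homogeneous of degree [d], [f - h] is the degree-[d] component of [f - g], which
     lies in [I] by homogeneity. *)
  pose h := DHomog (pihomogP mdeg d g).
  rewrite -[f](subrK h); apply: memv_add; last first.
    by apply/N_P; apply: supported_pihomog.
  apply/(homog_partP I_ideal).
  have := I_homog d _ Ig; rewrite pihomogB pihomog_dE //.
  exact: dhomog_is_dhomog.
(* With N the span of the outside terms: dim J_d + dim N = dim (J_d + N) <= dim S_d = dim (I_d + N)
   <= dim I_d + dim N. *)
rewrite -(leq_add2r (\dim (vspace_of out))) -(dimv_disjoint_sum cap0).
apply: leq_trans (dimvS (subvf _)) _.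
by rewrite -sum_full; case: (dimv_add_leqif (homog_part I d) (vspace_of out)).
Qed.

End Span.

Theorem corollary2p3 (K : fieldType) (n : nat)
    (J I : {mpoly K[n.+1]} -> Prop) (G : seq (marked_poly K n.+1))
    (J_monomial : monomial_ideal J) (J_stable : strongly_stable J)
    (I_homogeneous : homogeneous_ideal I)
    (G_marked : marked_set J G)
    (G_in_I : forall f, f \in G -> I (mpoly_of f)) :
  terms_span_quotient I (terms_outside J) /\
  (forall m : nat, \dim (homog_part J m) <= \dim (homog_part I m)).
Proof.
have red_I := reducible_marked J_stable I_homogeneous.1 G_marked G_in_I.
split; last exact: dim_homog_part_le.
move=> f; have [g out_g Ig] := red_I f.
by exists (msupp g), (fun m => mcoeff m g); rewrite -mpolyE.
Qed.
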